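(* Let $\beta>0$. Suppose that, for any constant input $\upsilon(t)=u$, the system $\dot\xi=f(\xi,\upsilon)$ has a unique equilibrium $w(u)$, which is globally exponentially stable; that $r\ge1$ is an integer such that $f$ is $(r+1)$-times and $h$ is $(r+2)$-times continuously differentiable, $\mathcal{X}_r\ne\emptyset$, $\frac{\partial \mathcal{L}_f^r h}{\partial u}(x,u)\ne0$ for all $(x,u)\in\mathcal{X}_r$ with $h_r(x,u)=0$, and $\frac{\partial\mathcal{L}_f^i h}{\partial u}(x,u)=0$ for all $(x,u)\in\mathcal{X}_r$ and all $i<r$; that $b$ is twice continuously differentiable, and $b(u)=0\implies\nabla b(u)\ne0$ for all $(x,u)$ with $h(x)\ge0$ and $b(u)\ge0$; and that $\Phi$ and $w$ are twice continuously differentiable. Let $(x_*,u_* )\in\mathbb{R}^n\times\mathbb{R}^m$ be a feasible point of the optimization problem $$\min_{x,u}\ \Phi(x)\quad\text{s.t.}\quad x=w(u),\ h(x)\ge0,\ b(u)\ge0.$$ Then $(x_*,u_* )\in\bigcap_{i=0}^r\mathcal{X}_i$.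
   Context: Conventions: for $g:\mathbb{R}^n\times\mathbb{R}^m\to\mathbb{R}^k$, $\frac{\partial g}{\partial x}(x,u)\in\mathbb{R}^{k\times n}$; for scalar $g$, $\nabla g=(\frac{\partial g}{\partial x})^\top$ is a column vector. Data: a control system $\dot\xi=f(\xi,\upsilon)$ with $f:\mathbb{R}^n\times\mathbb{R}^m\to\mathbb{R}^n$; functions $\Phi:\mathbb{R}^n\to\mathbb{R}$, $h:\mathbb{R}^n\to\mathbb{R}$, $b:\mathbb{R}^m\to\mathbb{R}$, sufficiently smooth. (A1) For any constant input $\upsilon(t)=u$, the system has a unique equilibrium, which is globally exponentially stable. $w:\mathbb{R}^m\to\mathbb{R}^n$ maps $u$ to this equilibrium, so $f(w(u),u)=0$. Notation: $\mathcal{L}_f h(x,u)=\frac{\partial h}{\partial x}(x)f(x,u)$ and $\mathcal{L}_f^i h(x,u)=\frac{\partial \mathcal{L}_f^{i-1}h}{\partial x}(x,u)f(x,u)$ for $i\ge2$. For a fixed $\beta>0$: $h_0(x,u):=h(x)$ and $h_i(x,u):=\frac{\partial h_{i-1}}{\partial x}(x,u)f(x,u)+\beta h_{i-1}(x,u)$ for $i\ge1$. Also $\mathcal{X}_i:=\{(x,u)\in\mathbb{R}^n\times\mathbb{R}^m: h(x)\ge0,\ b(u)\ge0,\ h_i(x,u)\ge0\}$ for $i\ge 0$. (A2) (1) There exists an integer $r\ge1$ such that: $f$ is $(r+1)$-times and $h$ is $(r+2)$-times continuously differentiable; $\mathcal{X}_r\ne\emptyset$; $\frac{\partial \mathcal{L}_f^r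 h}{\partial u}(x,u)\ne0$ for all $(x,u)\in\mathcal{X}_r$ with $h_r(x,u)=0$; and $\frac{\partial\mathcal{L}_f^i h}{\partial u}(x,u)=0$ for all $(x,u)\in\mathcal{X}_r$ and all $i<r$. (2) $b$ is twice continuously differentiable, and $b(u)=0\implies\nabla b(u)\ne0$ for all $(x,u)\in\mathcal{X}:=\{(x,u): h(x)\ge0,\ b(u)\ge0\}$. (3) $\Phi$ and $w$ are twice continuously differentiable. Throughout, $r$ is the integer in (A2). *)

(* Defs.v *)
From HB Require Import structures.
From mathcomp Require Import all_boot all_order all_algebra.
From mathcomp Require Import all_classical all_reals all_analysis.

Set Implicit Arguments.
Unset Strict Implicit.
Unset Printing Implicit Defensive.

Import Order.TTheory GRing.Theory Num.Theory.
Import numFieldNormedType.Exports.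

Local Open Scope classical_set_scope.
Local Open Scope ring_scope.

(* R^n is 'cV[R]_n and R^n x R^m is the product type 'cV[R]_n * 'cV[R]_m. *)

Section Calculus.
Context {R : realType}.

(* On finite-dimensional spaces, continuity of all k-fold iterated directional
   derivatives is continuity of the k-th derivative as a multilinear map. *)
Fixpoint Ck {V W : normedModType R} (k : nat) (g : V -> W) : Prop :=
  if k is k'.+1 then
    (forall x, differentiable g x) /\ (forall v, Ck k' ('D_v g))
  else continuous g.

(* The 1 x n matrix of partial derivatives. The values of 'D_v g are
   meaningful only where g is derivable. *)
Definition jacobian_row {n : nat} (g : 'cV[R]_n -> R) (x : 'cV[R]_n) :
    'rV[R]_n :=
  \row_j 'D_(delta_mx j 0) g x.

Definition grad {n : nat} (g : 'cV[R]_n -> R) (x : 'cV[R]_n) : 'cV[R]_n :=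
  (jacobian_row g x)^T.

Definition partial_x {n m : nat} (g : 'cV[R]_n * 'cV[R]_m -> R)
    (p : 'cV[R]_n * 'cV[R]_m) : 'rV[R]_n :=
  jacobian_row (fun x => g (x, p.2)) p.1.

Definition partial_u {n m : nat} (g : 'cV[R]_n * 'cV[R]_m -> R)
    (p : 'cV[R]_n * 'cV[R]_m) : 'rV[R]_m :=
  jacobian_row (fun u => g (p.1, u)) p.2.

End Calculus.

Section ControlSystem.
Context {R : realType} {n m : nat}.
Variable f : 'cV[R]_n * 'cV[R]_m -> 'cV[R]_n.

(* A classical solution on [0, +oo[ for the input upsilon. Only the restriction
   of xi to [0, +oo[ matters; at t = 0 only right-continuity is imposed, which,
   for continuous f and upsilon, yields the right derivative at 0. *)
Definition trajectory (upsilon : R -> 'cV[R]_m) (xi : R -> 'cV[R]_n) : Prop :=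
  {within [set t : R | 0 <= t], continuous xi} /\
  (forall t : R, 0 < t -> is_derive t 1 xi (f (xi t, upsilon t))).

Definition equilibrium (u : 'cV[R]_m) (x : 'cV[R]_n) : Prop := f (x, u) = 0.

(* The first conjunct excludes finite escape times, on which the estimate for
   solutions on [0, +oo[ is silent. The norm on 'cV[R]_n is the max norm; M
   absorbs the change from the Euclidean norm. *)
Definition globally_exponentially_stable (u : 'cV[R]_m) (xe : 'cV[R]_n) :
    Prop :=
  (forall x0 : 'cV[R]_n,
     exists xi, trajectory (fun=> u) xi /\ xi 0 = x0) /\
  (exists M lambda : R, [/\ 0 < M, 0 < lambda &
     forall xi, trajectory (fun=> u) xi -> forall t : R, 0 <= t ->
       `|xi t - xe| <= M * expR (- lambda * t) * `|xi 0 - xe|]).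

Definition lie (g : 'cV[R]_n * 'cV[R]_m -> R) (p : 'cV[R]_n * 'cV[R]_m) : R :=
  (partial_x g p *m f p) 0 0.

Variable h : 'cV[R]_n -> R.

(* The 0-th iterate is h itself, viewed as a function of (x, u). *)
Definition lie_iter (i : nat) : 'cV[R]_n * 'cV[R]_m -> R :=
  iter i lie (fun p => h p.1).

Fixpoint h_seq (beta : R) (i : nat) (p : 'cV[R]_n * 'cV[R]_m) : R :=
  if i is i'.+1 then lie (h_seq beta i') p + beta * h_seq beta i' p
  else h p.1.

Definition X_set (b : 'cV[R]_m -> R) (beta : R) (i : nat) :
    set ('cV[R]_n * 'cV[R]_m) :=
  [set p | [/\ 0 <= h p.1, 0 <= b p.2 & 0 <= h_seq beta i p]].

End ControlSystem.

(* The feasible set of: min Phi(x) s.t. x = w(u), h(x) >= 0, b(u) >= 0; it does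
   not depend on the objective Phi. *)
Definition feasible {R : realType} {n m : nat} (w : 'cV[R]_m -> 'cV[R]_n)
    (h : 'cV[R]_n -> R) (b : 'cV[R]_m -> R) : set ('cV[R]_n * 'cV[R]_m) :=
  [set p | [/\ p.1 = w p.2, 0 <= h p.1 & 0 <= b p.2]].

(* Main.v *)
Require Import Defs.
From HB Require Import structures.
From mathcomp Require Import all_boot all_order all_algebra.
From mathcomp Require Import all_classical all_reals all_analysis.

Import Order.TTheory GRing.Theory Num.Theory.
Import numFieldNormedType.Exports.

Local Open Scope classical_set_scope.
Local Open Scope ring_scope.

(** The Lie derivative of any function along f vanishes at an equilibrium,
    because it is linear in the value of f there. The recursion defining h_i
    therefore collapses to multiplication by beta, so that h_i equals
    beta ^ i times h at such a point and inherits the sign of h. A feasible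
    point is an equilibrium pair with h and b nonnegative, hence it lies in
    every X_i. *)

Lemma lie_equilibrium (R : realType) (n m : nat)
    (f : 'cV[R]_n * 'cV[R]_m -> 'cV[R]_n) (g : 'cV[R]_n * 'cV[R]_m -> R)
    (x : 'cV[R]_n) (u : 'cV[R]_m) :
  equilibrium f u x -> lie f g (x, u) = 0.
Proof. by rewrite /equilibrium /lie => ->; rewrite mulmx0 mxE. Qed.

Lemma h_seq_equilibrium (R : realType) (n m : nat)
    (f : 'cV[R]_n * 'cV[R]_m -> 'cV[R]_n) (h : 'cV[R]_n -> R) (beta : R)
    (x : 'cV[R]_n) (u : 'cV[R]_m) (i : nat) :
  equilibrium f u x -> h_seq f h beta i (x, u) = beta ^+ i * h x.
Proof.
move=> eq_xu; elim: i => [|i IHi] /=; first by rewrite expr0 mul1r.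
by rewrite lie_equilibrium// add0r IHi exprS mulrA.
Qed.

Theorem mainTheorem2 (R : realType) (n m : nat)
    (f : 'cV[R]_n * 'cV[R]_m -> 'cV[R]_n)
    (Phi : 'cV[R]_n -> R) (h : 'cV[R]_n -> R) (b : 'cV[R]_m -> R)
    (w : 'cV[R]_m -> 'cV[R]_n) (beta : R) (r : nat)
    (beta_gt0 : 0 < beta)
    (w_equilibrium : forall (u : 'cV[R]_m) (x : 'cV[R]_n),
       equilibrium f u x <-> x = w u)
    (w_stable : forall u : 'cV[R]_m, globally_exponentially_stable f u (w u))
    (r_ge1 : (1 <= r)%N)
    (f_smooth : Ck r.+1 f)
    (h_smooth : Ck r.+2 h)
    (X_nonempty : X_set f h b beta r !=set0)
    (relative_degree_r : forall p : 'cV[R]_n * 'cV[R]_m,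
       X_set f h b beta r p -> h_seq f h beta r p = 0 ->
       partial_u (lie_iter f h r) p <> 0)
    (relative_degree_lt : forall (p : 'cV[R]_n * 'cV[R]_m) (i : nat),
       X_set f h b beta r p -> (i < r)%N ->
       partial_u (lie_iter f h i) p = 0)
    (b_smooth : Ck 2 b)
    (b_regular : forall (x : 'cV[R]_n) (u : 'cV[R]_m),
       0 <= h x -> 0 <= b u -> b u = 0 -> grad b u <> 0)
    (Phi_smooth : Ck 2 Phi)
    (w_smooth : Ck 2 w)
    (x_star : 'cV[R]_n) (u_star : 'cV[R]_m)
    (star_feasible : feasible w h b (x_star, u_star)) :
  (\bigcap_(i in [set i : nat | (i <= r)%N]) X_set f h b beta i)
    (x_star, u_star).
Proof.
case: star_feasible => /= x_star_w h_ge0 b_ge0 i _; split=> //=.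
rewrite h_seq_equilibrium; last exact/w_equilibrium.
by rewrite mulr_ge0// exprn_ge0// ltW.
Qed.
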